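(* Let $n\ge0$ and $1\le j<4$ be integers and let $p$ be a prime such that $p\nmid(2n+1)$ and $p\equiv-1\pmod{2^{4-j}}$. Then for all integers $\alpha,k\ge1$, $$\overline{B}_{2^{\alpha}}\left(2^{\alpha}p^{2^j k-1}(2n+1)\right)\equiv 0 \pmod{2^6}.$$
   Context: For an integer $\ell\ge 2$, $\overline{B}_\ell(n)$ denotes the number of $\ell$-regular overpartition pairs of $n$ (pairs of overpartitions with no part divisible by $\ell$ and with total sum of parts $n$; an overpartition is a partition in which the last occurrence of each part size may be overlined). Its generating function, as a formal power series in $q$, is $$\sum_{n=0}^{\infty} \overline{B}_{\ell}(n) q^n =\frac{(-q;q)^2_\infty\,(q^\ell;q^\ell)^2_\infty}{(q;q)^2_\infty\, (-q^\ell;q^\ell)^2_\infty},$$ where $(x;q)_\infty=\prod_{i=0}^\infty(1-xq^i)$. *)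

(* Defs.v *)
From mathcomp Require Import all_boot all_order all_algebra.

Set Implicit Arguments.
Unset Strict Implicit.
Unset Printing Implicit Defensive.

(* A part of an overpartition is (size, overlined?). *)
Definition opart : Type := nat * bool.

(* Weakly decreasing, and an overlined part must be followed by a strictly
   smaller one: only the last occurrence of each size may be overlined. *)
Definition opart_geq : rel opart :=
  fun x y => (y.1 < x.1) || (x.1 == y.1) && ~~ x.2.

Definition overpartition (s : seq opart) : bool :=
  all (fun x => 0 < x.1) s && sorted opart_geq s.

Definition regular (l : nat) (s : seq opart) : bool :=
  all (fun x => ~~ (l %| x.1)) s.

Definition weight (s : seq opart) : nat := \sum_(x <- s) x.1.

Definition regular_overpartition_pair (l n : nat) (st : seq opart * seq opart) :=
  [&& overpartition st.1, regular l st.1,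
      overpartition st.2, regular l st.2
    & weight st.1 + weight st.2 == n].

(* An overpartition of weight at most n has at most n parts, all at most n.
   Hence the pairs to be counted all lie in the image of a finite type, as
   [encode_pairK] and [encode_pair_inj] show. *)
Definition bounded_seq (n : nat) := {bseq n of 'I_n.+1 * bool}.

Definition encode (n : nat) (s : bounded_seq n) : seq opart :=
  [seq (val x.1, x.2) | x <- s].

Definition encode_pair (n : nat) (st : bounded_seq n * bounded_seq n) :
  seq opart * seq opart := (encode st.1, encode st.2).

Definition Bbar (l n : nat) : nat :=
  #|[set st : bounded_seq n * bounded_seq n
      | regular_overpartition_pair l n (encode_pair st)]|.

Lemma encode_inj (n : nat) : injective (@encode n).
Proof.
move=> s t /inj_map eq_st; apply/val_inj/eq_st.
by move=> [i a] [j b] /= [/val_inj -> ->].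
Qed.

Lemma encode_pair_inj (n : nat) : injective (@encode_pair n).
Proof. by move=> [s t] [s' t'] [/encode_inj -> /encode_inj ->]. Qed.

Lemma encodeK (n : nat) (s : seq opart) :
  overpartition s -> weight s <= n -> exists t : bounded_seq n, encode t = s.
Proof.
case/andP=> s_gt0 _ le_sn.
have size_s : size s <= weight s.
  elim: s s_gt0 {le_sn} => //= x s IHs /andP[x_gt0 /IHs le_s].
  by rewrite /weight big_cons -add1n leq_add.
have size_t : size [seq (inord x.1 : 'I_n.+1, x.2) | x <- s] <= n.
  by rewrite size_map (leq_trans size_s).
exists (Bseq size_t); rewrite /encode /= -map_comp.
rewrite -[RHS]map_id; apply/eq_in_map => -[x b] x_s /=.
rewrite inordK // ltnS (leq_trans _ le_sn) // /weight.
by rewrite (big_rem _ x_s) /= leq_addr.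
Qed.

Lemma encode_pairK (l n : nat) (st : seq opart * seq opart) :
  regular_overpartition_pair l n st ->
  exists uv : bounded_seq n * bounded_seq n, encode_pair uv = st.
Proof.
case: st => s t /and5P[/= ov_s _ ov_t _ /eqP def_n].
have [||u <-] := @encodeK n s; rewrite -?def_n ?leq_addr //.
have [||v <-] := @encodeK n t; rewrite -?def_n ?leq_addl //.
by exists (u, v).
Qed.

(* Main.v *)
Require Import Defs.
From HB Require Import structures.
From mathcomp Require Import all_boot all_order all_algebra.
From mathcomp Require Import boolp ring zify.
Set Implicit Arguments.
Unset Strict Implicit.
Unset Printing Implicit Defensive.

(** Let [theta = prod_(r >= 1) (1 - q^r) / (1 + q^r)]. The series of [l]-regular
    overpartition pairs is [theta(q^l)^2 / theta(q)^2] ([Bbar_theta]), and Gauss's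
    identity [theta = sum_s (-1)^s q^(s^2)] ([theta_squares], by a telescoping
    finite form) makes theta-function arguments available.

    Take [l = 2^alpha] and coefficients at multiples [2^alpha m] with [m] odd.
    They are obtained by applying [alpha] times the operator [evenpart], which
    keeps the even exponents and halves them; since [evenpart (f g(q^2))] is
    [evenpart f * g], the numerator comes out as [y = theta^2], and one has to
    iterate [evenpart] on [1 / y]. Put [x = theta(-q)^2] and [t = x / y]. The
    product formula gives [x y = y(q^2)^2], and Gauss's identity together with
    [r_2(2 m) = r_2(m)] gives [evenpart x = x], that is, [x + y = 2 x(q^2)].
    These two relations determine [evenpart] on polynomials in [t] divided by
    [y]: [t^n / y] is sent to [T_(2 n + 1)(t) / y], with [T] the Chebyshev
    polynomials. In particular [1 / y] goes to [t / y], and [t / y] goes to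
    [(4 t^3 - 3 t) / y]. As [t = 1 + 8 u] with [u] integral, the latter is
    [(9 t - 8) / y] modulo [64], so all iterates have the form [(a + b t) / y]
    modulo [64] with integers [a] and [b] ([iter_evenpart_theta_inv]).

    The coefficient sought is therefore [b] times the one of [t] at [q^m]
    modulo [64]. It need not be computed through sums of four squares: the
    logarithmic derivative of the product shows [q t' = 8 t Lo] with [Lo] the
    sum of [sigma(m) q^m] over odd [m], and [t = 1 + 8 u] turns this into
    [m t_m = 8 sigma(m)] modulo [64] ([coef_theta_ratio]). Everything thus
    reduces to [8 | sigma(m)], where [m = p^(2^j k - 1) (2 n + 1)]. There
    [sigma(m)] has the factor [1 + p + ... + p^(2^j - 1)], which is the product
    of the [1 + p^(2^i)] for [i < j]: the first is divisible by [2^(4 - j)] and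
    the [j - 1] others are even. *)

(** * Formal power series *)

Section Series.
Local Open Scope ring_scope.
Import GRing.Theory.

Record fps (R : Type) := Fps { coefs :> nat -> R }.

HB.instance Definition _ (R : Type) := gen_eqMixin (fps R).
HB.instance Definition _ (R : Type) := gen_choiceMixin (fps R).

Lemma fpsP (R : Type) (f g : fps R) : (forall n, f n = g n) -> f = g.
Proof. by case: f g => f [g] /= /funext ->. Qed.

Section Ring.
Variable R : comNzRingType.
Implicit Types f g h : fps R.

Definition fps_zero : fps R := Fps (fun=> 0).
Definition fps_opp f : fps R := Fps (fun n => - f n).
Definition fps_add f g : fps R := Fps (fun n => f n + g n).

Fact fps_addA : associative fps_add.
Proof. by move=> f g h; apply: fpsP => n /=; rewrite addrA. Qed.
Fact fps_addC : commutative fps_add.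
Proof. by move=> f g; apply: fpsP => n /=; rewrite addrC. Qed.
Fact fps_add0 : left_id fps_zero fps_add.
Proof. by move=> f; apply: fpsP => n /=; rewrite add0r. Qed.
Fact fps_addN : left_inverse fps_zero fps_opp fps_add.
Proof. by move=> f; apply: fpsP => n /=; rewrite addNr. Qed.

HB.instance Definition _ :=
  GRing.isZmodule.Build (fps R) fps_addA fps_addC fps_add0 fps_addN.

Definition fps_one : fps R := Fps (fun n => (n == 0)%:R).
Fact fps_mul_key : unit. Proof. by []. Qed.
(** Sealed, so that simplification does not turn products into sums. *)
Definition fps_mul f g : fps R :=
  locked_with fps_mul_key (Fps (fun n => \sum_(j < n.+1) f j * g (n - j)%N)).
Lemma fps_mulE f g n : fps_mul f g n = \sum_(j < n.+1) f j * g (n - j)%N.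
Proof. by rewrite /fps_mul unlock. Qed.

Definition trunc N f : {poly R} := \poly_(i < N) f i.

(** Each coefficient of a product of series is a coefficient of a product of
    polynomials, so the ring axioms are inherited from polynomials. *)
Lemma fps_mul_trunc N f g n :
  (n < N)%N -> fps_mul f g n = (trunc N f * trunc N g)`_n.
Proof.
move=> nN; rewrite fps_mulE coefM; apply: eq_bigr => j _.
have le_jn : (j <= n)%N by rewrite -ltnS.
by rewrite !coef_poly (leq_ltn_trans le_jn nN) (leq_ltn_trans (leq_subr _ _) nN).
Qed.

Fact fps_mulC : commutative fps_mul.
Proof. by move=> f g; apply: fpsP => n; rewrite !(@fps_mul_trunc n.+1)// mulrC. Qed.

Fact fps_mulA : associative fps_mul.
Proof.
move=> f g h; apply: fpsP => n; rewrite !(@fps_mul_trunc n.+1)//.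
transitivity ((trunc n.+1 f * (trunc n.+1 g * trunc n.+1 h))`_n).
  rewrite !coefM; apply: eq_bigr => j _; congr (_ * _).
  rewrite coef_poly ltnS leq_subr.
  by rewrite -fps_mul_trunc // ltnS leq_subr.
rewrite mulrA !coefM; apply: eq_bigr => j _; congr (_ * _).
by rewrite [RHS]coef_poly ltn_ord -fps_mul_trunc.
Qed.

Fact fps_mul1 : left_id fps_one fps_mul.
Proof.
move=> f; apply: fpsP => n; rewrite fps_mulE.
by rewrite big_ord_recl /= mul1r subn0 big1 ?addr0 // => i _; rewrite mul0r.
Qed.

Fact fps_mulD : left_distributive fps_mul fps_add.
Proof.
move=> f g h; apply: fpsP => n; rewrite /= !fps_mulE.
by rewrite -big_split; apply: eq_bigr => i _; rewrite mulrDl.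
Qed.

Fact fps_one_neq0 : fps_one != 0.
Proof. by apply/eqP=> /(congr1 (fun f : fps R => f 0)) /eqP; rewrite oner_eq0. Qed.

HB.instance Definition _ := GRing.Zmodule_isComNzRing.Build (fps R)
  fps_mulA fps_mulC fps_mul1 fps_mulD fps_one_neq0.

Lemma fps1E n : (1 : fps R) n = (n == 0)%:R. Proof. by []. Qed.
Lemma fpsDE f g n : (f + g) n = f n + g n. Proof. by []. Qed.
Lemma fpsNE f n : (- f) n = - f n. Proof. by []. Qed.
Lemma fpsBE f g n : (f - g) n = f n - g n. Proof. by []. Qed.
Lemma fpsME f g n : (f * g) n = \sum_(j < n.+1) f j * g (n - j)%N.
Proof. exact: fps_mulE. Qed.
Lemma fpsM_trunc N f g n :
  (n < N)%N -> (f * g) n = (trunc N f * trunc N g)`_n.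
Proof. exact: fps_mul_trunc. Qed.

Lemma fps_sumE I (r : seq I) (P : pred I) (F : I -> fps R) n :
  (\sum_(i <- r | P i) F i) n = \sum_(i <- r | P i) F i n.
Proof. by elim/big_rec2: _ => // i _ y _ <-. Qed.

Lemma fpsMnE f k n : (f *+ k) n = f n *+ k.
Proof. by elim: k => // k IHk; rewrite !mulrS fpsDE IHk. Qed.

Lemma coef_natr k f n : (k%:R * f) n = k%:R * f n.
Proof. by rewrite !mulr_natl fpsMnE. Qed.

(** ** The indeterminate and congruences modulo its powers *)

Definition fpsX : fps R := Fps (fun n => (n == 1)%:R).
Local Notation q := fpsX.

Lemma coef_qXM k f n : (q ^+ k * f) n = if (n < k)%N then 0 else f (n - k)%N.
Proof.
elim: k n => [|k IHk] n; first by rewrite mul1r subn0.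
rewrite exprS -mulrA fpsME.
case: n => [|n]; first by rewrite big_ord1 mul0r.
rewrite 2!big_ord_recl /= mul0r add0r mul1r /bump /= subn1 IHk subSS.
by rewrite [X in _ + X]big1 ?addr0 // => i _; rewrite mul0r.
Qed.

Lemma coef_qX k n : (q ^+ k) n = (n == k)%:R.
Proof.
rewrite -[q ^+ k]mulr1 coef_qXM fps1E subn_eq0.
by case: ltngtP.
Qed.

(** Congruence modulo [q^N]. *)
Definition eqq N f g := forall n, (n < N)%N -> f n = g n.

Lemma eqq_sym N f g : eqq N f g -> eqq N g f.
Proof. by move=> fg n nN; rewrite fg. Qed.
Lemma eqq_trans N f g h : eqq N f g -> eqq N g h -> eqq N f h.
Proof. by move=> fg gh n nN; rewrite fg ?gh. Qed.
Lemma eqq_leq M N f g : (M <= N)%N -> eqq N f g -> eqq M f g.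
Proof. by move=> MN fg n nM; rewrite fg // (leq_trans nM). Qed.
Lemma eqqD N f f' g g' : eqq N f f' -> eqq N g g' -> eqq N (f + g) (f' + g').
Proof. by move=> ff gg n nN; rewrite !fpsDE ff ?gg. Qed.
Lemma eqqB N f f' g g' : eqq N f f' -> eqq N g g' -> eqq N (f - g) (f' - g').
Proof. by move=> ff gg n nN; rewrite !fpsBE ff ?gg. Qed.
Lemma eqqM N f f' g g' : eqq N f f' -> eqq N g g' -> eqq N (f * g) (f' * g').
Proof.
move=> ff gg n nN; rewrite !fpsME; apply: eq_bigr => j _.
have le_jn : (j <= n)%N by rewrite -ltnS.
by rewrite ff ?gg ?(leq_ltn_trans le_jn nN) // (leq_ltn_trans (leq_subr _ _) nN).
Qed.
Lemma eqqX N k f f' : eqq N f f' -> eqq N (f ^+ k) (f' ^+ k).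
Proof. by move=> ff; elim: k => // k IHk; rewrite !exprS; apply: eqqM. Qed.
Lemma eqq_qXM N k f : (N <= k)%N -> eqq N (q ^+ k * f) 0.
Proof. by move=> Nk n nN; rewrite coef_qXM (leq_trans nN). Qed.

Lemma eqq_all f g : (forall N, eqq N f g) -> f = g.
Proof. by move=> fg; apply: fpsP => n; apply: (fg n.+1). Qed.

(** ** Substitutions, even part and derivation *)

(** [dilate l f] is [f(q^l)]. *)
Definition dilate l f : fps R :=
  Fps (fun n => if (l %| n)%N then f (n %/ l)%N else 0).

Lemma dilateE l f n : dilate l f n = if (l %| n)%N then f (n %/ l)%N else 0.
Proof. by []. Qed.

Lemma coef_dilateM l f n : (0 < l)%N -> dilate l f (l * n)%N = f n.
Proof. by move=> l0; rewrite /= dvdn_mulr // mulKn. Qed.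

Fact dilate_nmod l : nmod_morphism (dilate l).
Proof.
split=> [|f g]; apply: fpsP => n; rewrite /= ?if_same //.
by case: ifP => _; rewrite ?addr0 ?fpsDE.
Qed.

Lemma coef_trunc_dilate l N f n : (0 < l)%N ->
  (n < N)%N -> (trunc N f \Po 'X^l)`_n = dilate l f n.
Proof.
move=> l0 nN; rewrite coef_comp_poly_Xn //= coef_poly.
by rewrite (leq_ltn_trans (leq_div _ _) nN).
Qed.

Fact dilate_monoid l : monoid_morphism (dilate l).
Proof.
split=> [|f g]; apply: fpsP => n.
  rewrite dilateE; case: ifP => [/dvdnP[k ->]|ln].
    case: l => [|l]; first by rewrite muln0.
    by rewrite mulnK // !fps1E muln_eq0 orbF.
  by case: n ln => //; rewrite dvdn0.
case: l => [|l].
  rewrite fpsME /=; case: (posnP n) => [->|n_gt0].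
    by rewrite big_ord1 dvdn0 div0n /= fpsME big_ord1.
  rewrite dvd0n eqn0Ngt n_gt0 /= big1 // => j _.
  rewrite !dvd0n; case: (posnP j) => [->|_]; last by rewrite mul0r.
  by rewrite subn0 eqn0Ngt n_gt0 mulr0.
rewrite [RHS](@fpsM_trunc n.+1) //.
transitivity (((trunc n.+1 f * trunc n.+1 g) \Po 'X^(l.+1))`_n).
  rewrite coef_comp_poly_Xn //=; case: ifP => // _.
  by rewrite (@fpsM_trunc n.+1) // ltnS leq_div.
rewrite comp_polyM !coefM; apply: eq_bigr => j _.
rewrite !coef_trunc_dilate // ?ltnS ?leq_subr // !coef_poly ltn_ord.
by rewrite ltnS leq_subr.
Qed.

HB.instance Definition _ l := GRing.isNmodMorphism.Build _ _ _ (dilate_nmod l).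
HB.instance Definition _ l :=
  GRing.isMonoidMorphism.Build _ _ _ (dilate_monoid l).

Lemma dilate_q l : (0 < l)%N -> dilate l q = q ^+ l.
Proof.
move=> l0; apply: fpsP => n; rewrite coef_qX /=.
case: ifP => [/dvdnP[k ->]|].
  by rewrite mulnK // -{2}[l]mul1n eqn_pmul2r.
by case: eqP => // ->; rewrite dvdnn.
Qed.

Lemma dilate_comp k l f : (0 < l)%N -> dilate k (dilate l f) = dilate (k * l) f.
Proof.
move=> l0; apply: fpsP => n /=.
case: (posnP k) => [->|k0].
  rewrite mul0n !dvd0n; case: eqP => // ->.
  by rewrite div0n dvdn0 div0n.
case: (boolP (k %| n)%N) => [/dvdnP[m ->]|kn].
  by rewrite mulnK // (mulnC m) dvdn_pmul2l // divnMl.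
by case: ifP => // /(dvdn_trans (dvdn_mulr l (dvdnn k))) kn'; rewrite kn' in kn.
Qed.

Lemma dilate1 f : dilate 1 f = f.
Proof. by apply: fpsP => n; rewrite /= dvd1n divn1. Qed.

Lemma eqq_dilate N l f g : (0 < l)%N -> eqq N f g ->
  eqq (l * N) (dilate l f) (dilate l g).
Proof.
move=> l0 fg n nN /=; case: ifP => // ln; apply: fg.
by rewrite ltn_divLR // mulnC.
Qed.

(** [twist f] is [f(-q)]. *)
Definition twist f : fps R := Fps (fun n => (-1) ^+ n * f n).

Lemma twistE f n : twist f n = (-1) ^+ n * f n. Proof. by []. Qed.

Fact twist_nmod : nmod_morphism twist.
Proof.
split=> [|f g]; apply: fpsP => n; rewrite /= ?mulr0 //.
by rewrite mulrDr.
Qed.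

Fact twist_monoid : monoid_morphism twist.
Proof.
split=> [|f g]; apply: fpsP => n /=.
  by case: n => [|n]; rewrite ?mulr1 ?mulr0.
rewrite !fpsME big_distrr /=; apply: eq_bigr => j _.
have le_jn : (j <= n)%N by rewrite -ltnS.
by rewrite -{1}(subnKC le_jn) exprD mulrACA.
Qed.

HB.instance Definition _ := GRing.isNmodMorphism.Build _ _ _ twist_nmod.
HB.instance Definition _ := GRing.isMonoidMorphism.Build _ _ _ twist_monoid.

Lemma twistK : involutive twist.
Proof. by move=> f; apply: fpsP => n /=; rewrite mulrA -expr2 sqrr_sign mul1r. Qed.

Lemma twist_q : twist q = - q.
Proof.
apply: fpsP => n; rewrite fpsNE /=.
by case: eqP => [->|_]; rewrite ?expr1 ?mulr1 // mulr0 oppr0.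
Qed.

Lemma twist_dilate2 f : twist (dilate 2 f) = dilate 2 f.
Proof.
apply: fpsP => n /=; case: ifP => [/dvdnP[k ->]|]; last by rewrite mulr0.
by rewrite mulnC exprM sqrrN expr1n expr1n mul1r.
Qed.

Definition evenpart f : fps R := Fps (fun n => f (2 * n)%N).

Fact evenpart_nmod : nmod_morphism evenpart.
Proof. by split=> [|f g]; apply: fpsP. Qed.
HB.instance Definition _ := GRing.isNmodMorphism.Build _ _ _ evenpart_nmod.

(** Identities for even parts are proved through this equation: over the
    integers both doubling and [dilate 2] are injective. *)
Lemma dilate_evenpart f : 2%:R * dilate 2 (evenpart f) = f + twist f.
Proof.
apply: fpsP => n; rewrite coef_natr fpsDE /=.
case: ifP => [/dvdnP[k ->]|n2].
  by rewrite mulnK // (mulnC k) exprM sqrrN !expr1n mul1r mulr_natl mulr2n.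
move: n2; rewrite dvdn2 => /negbT/negbNE n_odd.
by rewrite -signr_odd n_odd expr1 mulN1r subrr mulr0.
Qed.

(** [qderiv f] is [q f'(q)], which, unlike [f'(q)], does not shift degrees. *)
Definition qderiv f : fps R := Fps (fun n => n%:R * f n).

Fact qderiv_nmod : nmod_morphism qderiv.
Proof.
by split=> [|f g]; apply: fpsP => n; rewrite /= ?mulr0 // mulrDr.
Qed.
HB.instance Definition _ := GRing.isNmodMorphism.Build _ _ _ qderiv_nmod.

Lemma qderivM f g : qderiv (f * g) = qderiv f * g + f * qderiv g.
Proof.
apply: fpsP => n; rewrite fpsDE /= !fpsME big_distrr -big_split /=.
apply: eq_bigr => j _; have le_jn : (j <= n)%N by rewrite -ltnS.
rewrite -{1}(subnKC le_jn) natrD; ring.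
Qed.

Lemma qderiv_qX k : qderiv (q ^+ k) = k%:R * q ^+ k.
Proof.
apply: fpsP => n; rewrite coef_natr /= !coef_qX.
by case: eqP => [->|]; rewrite ?mulr0.
Qed.

Lemma qderiv1 : qderiv 1 = 0.
Proof. by apply: fpsP => -[|n]; rewrite /= ?mul0r ?mulr0. Qed.

Lemma qderiv_twist f : qderiv (twist f) = twist (qderiv f).
Proof. by apply: fpsP => n /=; rewrite mulrCA. Qed.

Lemma eqq_qderiv N f g : eqq N f g -> eqq N (qderiv f) (qderiv g).
Proof. by move=> fg n nN /=; rewrite fg. Qed.

(** ** Units *)

(** Invertibility and inverses are taken classically; [fps_unit1] gives a
    sufficient condition on the constant coefficient. *)
Definition fps_unit : {pred fps R} := fun f => `[< exists g, g * f = 1 >].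

Definition fps_inv f : fps R :=
  if pselect (exists g, g * f = 1) is left e then projT1 (cid e) else f.

Fact fps_mulV : {in fps_unit, left_inverse 1 fps_inv *%R}.
Proof.
move=> f; rewrite unfold_in /fps_inv => /asboolP fU.
by case: pselect => // e; case: cid.
Qed.

Fact fps_unitPl f g : g * f = 1 -> fps_unit f.
Proof. by move=> gf; apply/asboolP; exists g. Qed.

Fact fps_inv_out : {in [predC fps_unit], fps_inv =1 id}.
Proof.
move=> f; rewrite inE unfold_in /fps_inv => /asboolP fU.
by case: pselect.
Qed.

HB.instance Definition _ := GRing.ComNzRing_hasMulInverse.Build (fps R)
  fps_mulV fps_unitPl fps_inv_out.

(** Geometric series: only the powers [(1 - f)^k] with [k <= n] reach the
    coefficient of [q^n] of the inverse of [f]. *)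
Lemma fps_unit1 f : f 0 = 1 -> f \is a GRing.unit.
Proof.
move=> f0; pose h := 1 - f.
have hX k : eqq k (h ^+ k) 0.
  elim: k => // k IHk n; rewrite ltnS => le_nk.
  rewrite exprS fpsME big1 // => -[[|j] jn] _; rewrite ?[Ordinal _ : nat]/=.
    by rewrite /h fpsBE fps1E f0 subrr mul0r.
  rewrite IHk ?mulr0 //; rewrite ltnS in jn.
  by apply: leq_trans le_nk; rewrite -subSn // subSS leq_subr.
pose g : fps R := Fps (fun n => (\sum_(k < n.+1) h ^+ k) n).
apply/asboolP; exists g; apply: eqq_all => N.
apply: (@eqq_trans _ _ ((\sum_(k < N) h ^+ k) * f)).
  apply: eqqM => // n nN; rewrite [g n]/= !fps_sumE.
  rewrite (big_ord_widen N (fun k => (h ^+ k) n)) //.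
  rewrite [RHS](bigID (fun k : 'I_N => (k < n.+1)%N)) /=.
  rewrite [X in _ = _ + X]big1 ?addr0 // => k; rewrite ltnS -ltnNge => nk.
  by rewrite hX.
have -> : (\sum_(k < N) h ^+ k) * f = 1 - h ^+ N.
  by rewrite mulrC -[1 - _]opprB subrX1 -mulNr /h opprB subKr.
by rewrite -[X in eqq N _ X]subr0; apply: eqqB.
Qed.

End Ring.
End Series.

(** * Gauss's theta product *)

Section Shanks.
Local Open Scope ring_scope.
Import GRing.Theory.

Variables (A : comNzRingType) (z : A) (a : nat -> A).
Hypotheses (a0 : a 0 = 0) (aE : forall r, (1 + z ^+ r) * a r = 1 - z ^+ r).

Definition shanks_term n s :=
  (-1) ^+ s * z ^+ (s * n.+1) * (1 + a s) * \prod_(s.+1 <= r < n.+1) a r.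

(** Each step of the induction on [m] comes from [(1 + z^r) a_r = 1 - z^r] for
    [r = m] and [r = n + 1]; the case [m = 0] is [a_0 = 0]. *)
Lemma shanks_telescope n m : (m <= n.+1)%N ->
  \sum_(0 <= s < m) (shanks_term n.+1 s - shanks_term n s) =
  (-1) ^+ m * z ^+ (m * n.+1) * (1 + a n.+1) * \prod_(m <= r < n.+1) a r.
Proof.
elim: m => [|m IHm] m_n; first
  by rewrite big_nil [\prod_(_ <= _ < _) _]big_ltn // a0 mul0r mulr0.
rewrite big_nat_recr //= IHm 1?ltnW // /shanks_term.
rewrite (@big_nat_recr _ _ _ n.+1 m.+1) //= (@big_ltn _ _ _ m n.+1) //.
set B := \prod_(m.+1 <= r < n.+1) a r.
rewrite [in (m * n.+2)%N]mulnS mulSn !exprD exprS.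
have := aE m; have := aE n.+1.
move: (a m) (a n.+1) (z ^+ m) (z ^+ n.+1) (z ^+ (m * n.+1)) ((-1) ^+ m).
move=> x y u v w e.
move=> yE xE.
transitivity (e * w * B * (y * ((1 + u) * x) + u * y - 1 + (1 + v) * y + v - y - v * y
  - (1 + y) * v + y * v)); first by ring.
rewrite yE xE; ring.
Qed.

(** Shanks's finite form of Gauss's identity: the terms with [s > 0] on the left
    are divisible by [z^(n + 1)], and the one with [s = 0] is a partial product. *)
Lemma shanks_identity n :
  \sum_(0 <= s < n.+1) shanks_term n s =
  1 + 2%:R * \sum_(1 <= s < n.+1) (-1) ^+ s * z ^+ (s ^ 2).
Proof.
elim: n => [|n IHn].
  by rewrite big_nat1 /shanks_term !big_geq // a0 !mulr0 mul0n !addr0 !mulr1.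
rewrite [in RHS]big_nat_recr //= mulrDr addrA -IHn big_nat_recr //=.
have /eqP := shanks_telescope (leqnn n.+1).
rewrite sumrB subr_eq (@big_geq _ _ _ n.+1 n.+1) // => /eqP ->.
set S := \sum_(_ <= _ < _) _.
rewrite /shanks_term (@big_geq _ _ _ n.+2 n.+2) // !mulr1 -mulnn.
have -> : z ^+ (n.+1 * n.+2) = z ^+ (n.+1 * n.+1) * z ^+ n.+1.
  by rewrite -exprD addnC -mulnS.
have yE := aE n.+1.
transitivity (S + (-1) ^+ n.+1 * z ^+ (n.+1 * n.+1)
  * (1 + z ^+ n.+1 + (1 + z ^+ n.+1) * a n.+1)).
  move: (z ^+ (n.+1 * n.+1)) (z ^+ n.+1) ((-1) ^+ n.+1) => w v e; ring.
by rewrite yE addrACA subrr addr0 -mulr2n mulr_natl mulr_natr.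
Qed.

End Shanks.

(** ** The product *)

Section Theta.
Local Open Scope ring_scope.
Import GRing.Theory Num.Theory.
Local Notation series := (fps int).
Local Notation q := (fpsX int).

Lemma mulfps_natI k : (0 < k)%N -> injective (fun f : series => k%:R * f).
Proof.
move=> k0 f g /= fg; apply: fpsP => n.
have := congr1 (fun h : series => h n) fg; rewrite !coef_natr => /mulfI -> //.
by rewrite pnatr_eq0 -lt0n.
Qed.

(** For [r = 0] this is [0 / 2 = 0], the value that [shanks_identity] needs. *)
Definition theta_factor r : series := (1 - q ^+ r) / (1 + q ^+ r).

Lemma qX_coef0 r : (0 < r)%N -> (q ^+ r) 0 = 0.
Proof. by rewrite coef_qX; case: r. Qed.

Lemma addq_unit r : (0 < r)%N -> 1 + q ^+ r \is a GRing.unit.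
Proof. by move=> r0; apply: fps_unit1; rewrite fpsDE fps1E qX_coef0. Qed.

Lemma subq_unit r : (0 < r)%N -> 1 - q ^+ r \is a GRing.unit.
Proof. by move=> r0; apply: fps_unit1; rewrite fpsBE fps1E qX_coef0. Qed.

Lemma theta_factorE r : (1 + q ^+ r) * theta_factor r = 1 - q ^+ r.
Proof.
case: r => [|r]; first by rewrite /theta_factor subrr mul0r mulr0.
by rewrite mulrC divrK // addq_unit.
Qed.

Lemma theta_factor0 : theta_factor 0 = 0.
Proof. by rewrite /theta_factor subrr mul0r. Qed.

Lemma theta_factor_unit r : (0 < r)%N -> theta_factor r \is a GRing.unit.
Proof. by move=> r0; rewrite unitrM unitrV addq_unit // subq_unit. Qed.

Lemma eqq_theta_factor r : eqq r (theta_factor r) 1.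
Proof.
have -> : theta_factor r = 1 - q ^+ r * (1 + theta_factor r).
  have := theta_factorE r; rewrite mulrDl mul1r => /(congr1 (fun f => f - q ^+ r * theta_factor r)).
  by rewrite addrK => aE; rewrite [LHS]aE; ring.
by rewrite -[X in eqq _ _ X]subr0; apply: eqqB => //; apply: eqq_qXM.
Qed.

Definition theta_partial n : series := \prod_(1 <= r < n.+1) theta_factor r.

Lemma theta_partialS n : theta_partial n.+1 = theta_partial n * theta_factor n.+1.
Proof. by rewrite /theta_partial big_nat_recr. Qed.

Lemma eqq_theta_partial m n : (m <= n)%N -> eqq m.+1 (theta_partial n) (theta_partial m).
Proof.
move=> /subnK <-; elim: (n - m)%N => // k IHk.
rewrite addSn theta_partialS -[theta_partial m]mulr1; apply: eqqM => //.
by apply: eqq_leq (eqq_theta_factor (r := (k + m).+1)); rewrite ltnS leq_addl.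
Qed.

(** The infinite product of the [theta_factor r]: by [eqq_theta_partial] the
    coefficient of [q^n] is the same in all partial products from the [n]-th on. *)
Definition theta : series := Fps (fun n => theta_partial n n).

Lemma eqq_theta n : eqq n.+1 theta (theta_partial n).
Proof. by move=> m mn; rewrite /= (@eqq_theta_partial m n). Qed.

Lemma theta_squares n :
  eqq n.+1 theta (1 + 2%:R * \sum_(1 <= s < n.+1) (-1) ^+ s * q ^+ (s ^ 2)).
Proof.
apply: eqq_trans (@eqq_theta n) _.
rewrite -(shanks_identity theta_factor0 theta_factorE) big_ltn // -[theta_partial n]addr0.
apply: eqqD; first by rewrite /shanks_term !mul1r theta_factor0 addr0 mul1r.
move=> m mn; rewrite fps_sumE big_nat_cond big1 // => s /andP[/andP[s0 _] _].
rewrite /shanks_term -!mulrA mulrCA (@eqq_qXM _ n.+1) //.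
exact: leq_pmull.
Qed.

Lemma theta_coef0 : theta 0 = 1.
Proof. by rewrite /= /theta_partial big_nil. Qed.

Lemma theta_unit : theta \is a GRing.unit.
Proof. exact/fps_unit1/theta_coef0. Qed.

Lemma theta_odd : exists S, theta = 1 + 2%:R * S.
Proof.
exists (Fps (fun n => (\sum_(1 <= s < n.+1) (-1) ^+ s * q ^+ (s ^ 2)) n)).
by apply: fpsP => n; rewrite (@theta_squares n) // !fpsDE !coef_natr.
Qed.

Lemma dilate_theta_factor l r : (0 < l)%N -> dilate l (theta_factor r) = theta_factor (l * r).
Proof.
move=> l0; case: r => [|r]; first by rewrite muln0 theta_factor0 rmorph0.
rewrite /theta_factor rmorphM rmorphV ?addq_unit //.
by rewrite rmorphB rmorphD rmorph1 rmorphXn /= dilate_q // -exprM.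
Qed.

Lemma twist_theta_factor r : (0 < r)%N ->
  twist (theta_factor r) = if odd r then (theta_factor r)^-1 else theta_factor r.
Proof.
move=> r0; rewrite /theta_factor rmorphM rmorphV ?addq_unit //.
rewrite rmorphB rmorphD rmorph1 rmorphXn /= twist_q exprNn -signr_odd.
case: odd; last by rewrite mul1r.
by rewrite expr1 mulN1r opprK invrM ?unitrV ?addq_unit ?subq_unit // invrK mulrC.
Qed.

Lemma eqq_twist N (f g : series) : eqq N f g -> eqq N (twist f) (twist g).
Proof. by move=> fg n nN /=; rewrite fg. Qed.

(** Twisting inverts the factors of odd index, so that they cancel, and fixes
    those of even index, which are the factors of [theta(q^2)]. *)
Lemma theta_twist : theta * twist theta = dilate 2 theta ^+ 2.
Proof.
have partial2 n : theta_partial (2 * n) * twist (theta_partial (2 * n)) =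
      dilate 2 (theta_partial n) ^+ 2.
  elim: n => [|n IHn]; first by rewrite muln0 /theta_partial !big_nil !rmorph1 mulr1 expr1n.
  have tS m : twist (theta_partial m.+1) =
      twist (theta_partial m) * twist (theta_factor m.+1).
    by rewrite theta_partialS rmorphM.
  have dS : dilate 2 (theta_partial n.+1) =
      dilate 2 (theta_partial n) * dilate 2 (theta_factor n.+1).
    by rewrite theta_partialS rmorphM.
  rewrite mulnS !tS dS !theta_partialS exprMn -IHn dilate_theta_factor // !twist_theta_factor //.
  rewrite /= mul2n odd_double /= -mul2n mulnS add2n.
  have : theta_factor (2 * n).+1 / theta_factor (2 * n).+1 = 1 by apply/divrr/theta_factor_unit.
  move: (theta_factor _)^-1 => v vE; rewrite -[theta_factor (_.+2) ^+ 2]mul1r -vE; ring.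
apply: eqq_all => N; case: N => // n.
apply: (@eqq_trans _ _ _ (theta_partial (2 * n) * twist (theta_partial (2 * n)))).
  have n2 : (n.+1 <= (2 * n).+1)%N by rewrite ltnS leq_pmull.
  by apply: eqqM; [|apply: eqq_twist]; apply: eqq_leq (eqq_theta (n := _)).
rewrite partial2; apply: eqq_sym; apply: eqqX.
apply: (@eqq_leq _ _ (2 * n.+1)); first by rewrite leq_pmull.
by apply: eqq_dilate => //; apply: eqq_theta.
Qed.

(** ** Logarithmic derivative *)

(** The series of [q^r / (1 - q^(2 r))]. *)
Definition odd_multiples r : series :=
  Fps (fun m => ((r %| m)%N && odd (m %/ r))%:R).

Lemma odd_multiplesE r : (0 < r)%N ->
  (1 - q ^+ (2 * r)) * odd_multiples r = q ^+ r.
Proof.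
move=> r0; rewrite mulrBl mul1r; apply: fpsP => m.
rewrite fpsBE coef_qXM coef_qX /=.
case: (boolP (r %| m)%N) => [/dvdnP[k ->]|rm]; last first.
  have -> : (m == r) = false by apply: contraNF rm => /eqP ->.
  case: ltnP => [_|le_m]; first by rewrite subr0.
  by rewrite dvdn_subl ?dvdn_mull // (negPf rm) subr0.
rewrite ltn_pmul2r // -mulnBl dvdn_mull //= !mulnK //.
rewrite -{2}[r]mul1n eqn_pmul2r //.
case: k => [|[|k]] //=; rewrite ?subr0 //.
by rewrite subn2 /= negbK subrr.
Qed.

Lemma qderiv_theta_factor r : (0 < r)%N ->
  qderiv (theta_factor r) = - 2%:R * theta_factor r * (r%:R * odd_multiples r).
Proof.
move=> r0; have U := addq_unit r0; apply: (mulrI U); apply: (mulrI U).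
have DE := congr1 (@qderiv _) (theta_factorE r).
rewrite qderivM raddfD raddfB /= qderiv1 qderiv_qX add0r sub0r in DE.
have gE := odd_multiplesE r0; rewrite mulnC exprM in gE.
suff gen (d a g x k : series) : k * x * a + (1 + x) * d = - (k * x) ->
    (1 - x ^+ 2) * g = x -> (1 + x) * a = 1 - x ->
    (1 + x) * ((1 + x) * d) = (1 + x) * ((1 + x) * (- 2%:R * a * (k * g))).
  exact: gen DE gE (theta_factorE r).
move=> {}DE {}gE aE; transitivity (- (2%:R * k) * x).
  transitivity ((1 + x) * (k * x * a + (1 + x) * d) - k * x * ((1 + x) * a)).
    by ring.
  rewrite DE aE; ring.
rewrite -[in LHS]gE.
transitivity (- (2%:R * k) * ((1 + x) * (1 - x) * g)); first by ring.
rewrite -aE; ring.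
Qed.

(** The Lambert series [sum_r r q^r / (1 - q^(2 r))]: the terms with [d > m] do
    not reach the coefficient of [q^m]. *)
Definition lambert : series :=
  Fps (fun m => \sum_(1 <= d < m.+1) d%:R * odd_multiples d m).

Lemma qderiv_theta : qderiv theta = - 2%:R * theta * lambert.
Proof.
have D n : qderiv (theta_partial n) =
    - 2%:R * theta_partial n * \sum_(1 <= r < n.+1) r%:R * odd_multiples r.
  elim: n => [|n IHn]; first by rewrite /theta_partial !big_nil qderiv1 mulr0.
  rewrite theta_partialS qderivM IHn qderiv_theta_factor // [in RHS]big_nat_recr //=; ring.
apply: eqq_all => -[//|n].
apply: eqq_trans (eqq_qderiv (@eqq_theta n)) _; rewrite D.
apply: eqqM; first by apply: eqqM => //; apply/eqq_sym/eqq_theta.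
move=> m; rewrite ltnS fps_sumE => mn.
under eq_bigr do rewrite coef_natr.
rewrite (@big_cat_nat _ _ _ m.+1) //= [X in _ + X]big_nat_cond [X in _ + X]big1 ?addr0 // => r.
move=> /andP[/andP[mr _] _]; case: (posnP m) => [->|m0].
  by rewrite div0n andbF mulr0.
by rewrite gtnNdvd // mulr0.
Qed.

End Theta.

(** * Sums of two squares *)

Section TwoSquares.
Local Open Scope ring_scope.
Import GRing.Theory Num.Theory.
Local Notation series := (fps int).
Local Notation q := (fpsX int).

Definition int_ball N : seq int :=
  [seq Posz i | i <- iota 0 N.+1] ++ [seq Negz i | i <- iota 0 N].

Lemma mem_int_ball N a : (a \in int_ball N) = (`|a| <= N)%N.
Proof.
rewrite mem_cat; case: a => i.
  have -> : (Posz i \in [seq Negz k | k <- iota 0 N]) = false.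
    by apply/negP => /mapP[].
  by rewrite mem_map ?mem_iota ?orbF // => x y [].
have -> : (Negz i \in [seq Posz k | k <- iota 0 N.+1]) = false.
  by apply/negP => /mapP[].
by rewrite mem_map ?mem_iota // => x y [].
Qed.

Lemma int_ball_uniq N : uniq (int_ball N).
Proof.
rewrite cat_uniq !map_inj_uniq ?iota_uniq ?andbT; try by move=> x y [].
by apply/hasPn => x /mapP[i _ ->]; apply/mapP => -[].
Qed.

Lemma sum_int_ball (V : nmodType) N (F : nat -> V) :
  \sum_(a <- int_ball N) F `|a|%N = F 0 + (\sum_(1 <= s < N.+1) F s) *+ 2.
Proof.
rewrite big_cat !big_map /= big_cons -addrA mulr2n /index_iota subn1 /=.
congr (_ + (_ + _)).
by rewrite -(addn0 1%N) iotaDl big_map.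
Qed.

Lemma twist_theta_squares N :
  eqq N.+1 (twist theta) (\sum_(a <- int_ball N) q ^+ (`|a| ^ 2)).
Proof.
rewrite (sum_int_ball N (fun s => q ^+ (s ^ 2))) -mulr_natl.
have := eqq_twist (@theta_squares N).
rewrite rmorphD rmorph1 rmorphM rmorph_nat rmorph_sum /=.
congr (eqq _ _ (_ + _ * _)); apply: eq_bigr => s _.
rewrite rmorphM rmorphXn rmorphN1 rmorphXn /= twist_q [(- q) ^+ _]exprNn mulrA.
by rewrite -exprD -signr_odd oddD oddX /= addbb mul1r.
Qed.

Definition two_squares N m : seq (int * int) :=
  [seq ab <- [seq (a, b) | a <- int_ball N, b <- int_ball N] |
   ab.1 ^+ 2 + ab.2 ^+ 2 == m%:Z].

Lemma two_squares_uniq N m : uniq (two_squares N m).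
Proof.
by apply/filter_uniq/allpairs_uniq => [||[a b] [c d] _ _ []]; rewrite ?int_ball_uniq // => -> ->.
Qed.

Lemma mem_two_squares N m a b : (m <= N)%N ->
  ((a, b) \in two_squares N m) = (a ^+ 2 + b ^+ 2 == m%:Z).
Proof.
move=> mN; rewrite mem_filter; case: eqP => // abm.
by rewrite /= in abm; apply/allpairsP; exists (a, b); rewrite !mem_int_ball; split=> //=; nia.
Qed.

Lemma coef_twist_theta_sqr N m : (m <= N)%N ->
  (twist theta ^+ 2) m = (size (two_squares N m))%:Z.
Proof.
move=> mN; rewrite (eqqX 2 (@twist_theta_squares N)) // expr2 big_distrlr /=.
rewrite fps_sumE; under eq_bigr do rewrite fps_sumE.
rewrite size_filter -sum1_count [in RHS]big_mkcond big_allpairs.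
rewrite -natz natr_sum; apply: eq_bigr => a _.
rewrite natr_sum; apply: eq_bigr => b _; rewrite -exprD coef_qX /=.
have -> : (m == `|a| ^ 2 + `|b| ^ 2)%N = (a ^+ 2 + b ^+ 2 == m%:Z) by lia.
by case: ifP.
Qed.

(** [(a, b) |-> (a + b, a - b)] maps the representations of [m] onto those of
    [2 m]: two integers whose squares have an even sum have the same parity. *)
Lemma size_two_squares2 N m : (2 * m <= N)%N ->
  size (two_squares N (2 * m)) = size (two_squares N m).
Proof.
move=> mN; have mN' : (m <= N)%N by lia.
rewrite -[RHS](size_map (fun ab : int * int => (ab.1 + ab.2, ab.1 - ab.2))).
apply/perm_size/uniq_perm; first exact: two_squares_uniq.
  rewrite map_inj_in_uniq ?two_squares_uniq // => -[a b] [c d] _ _ /= [].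
  by move=> e1 e2; congr (_, _); lia.
move=> [c d]; rewrite mem_two_squares //; apply/eqP/mapP => [cd|[[a b]]].
  have [u cE] : exists u, c + d = 2 * u.
    exists ((c + d) %/ 2)%Z; move: cd.
    have := divz_eq c 2; have := divz_eq d 2.
    have := modz_ge0 c (isT : 2 != 0 :> int); have := modz_ge0 d (isT : 2 != 0 :> int).
    have := ltz_pmod c (isT : 0 < 2 :> int); have := ltz_pmod d (isT : 0 < 2 :> int).
    nia.
  exists (u, u - d); first by rewrite mem_two_squares //; apply/eqP; nia.
  by congr (_, _) => /=; lia.
rewrite mem_two_squares // => /eqP ab [-> ->]; nia.
Qed.

(** The coefficient of [q^m] in [theta(-q)^2] is the number [r_2(m)] of
    representations by two squares, and [r_2(2 m) = r_2(m)]. *)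
Lemma evenpart_theta_sqr : evenpart (twist theta ^+ 2) = twist theta ^+ 2.
Proof.
apply: fpsP => m; rewrite [LHS]/= [LHS](@coef_twist_theta_sqr (2 * m)) //.
by rewrite size_two_squares2 // -coef_twist_theta_sqr // leq_pmull.
Qed.

End TwoSquares.

(** * The even-part recursion modulo 64 *)

Section Recursion.
Local Open Scope ring_scope.
Import GRing.Theory Num.Theory.
Local Notation series := (fps int).
Local Notation q := (fpsX int).

Lemma evenpart_unique (f g : series) :
  2%:R * dilate 2 g = f + twist f -> evenpart f = g.
Proof.
rewrite -dilate_evenpart => /(@mulfps_natI 2 isT) /= fg; apply: fpsP => n.
by have := congr1 (fun h : series => h (2 * n)%N) fg; rewrite !coef_dilateM.
Qed.

Lemma evenpart_dilate2M (f g : series) :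
  evenpart (f * dilate 2 g) = evenpart f * g.
Proof.
apply: evenpart_unique.
by rewrite !rmorphM /= twist_dilate2 mulrA dilate_evenpart mulrDl.
Qed.

(** Writing [Y] for [b(q^2)], the hypotheses say that [a] and [b] are the roots
    of [z^2 - 2 a(q^2) z + Y^2], so the even part [(a^n + b^n) / 2] of [a^n] is
    [Y^n T_n(a(q^2) / Y)] for the Chebyshev polynomial [T_n]; here [n = 3]. *)
Lemma evenpart_cube (a b : series) :
  twist a = b -> a + b = 2%:R * dilate 2 a -> a * b = dilate 2 b ^+ 2 ->
  evenpart (a ^+ 3) = 4%:R * a ^+ 3 - 3%:R * a * b ^+ 2.
Proof.
move=> ab sE pE; apply: evenpart_unique.
rewrite rmorphXn /= ab rmorphB rmorphM rmorphXn rmorphM rmorphXn rmorphM !rmorph_nat /=.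
transitivity ((2%:R * dilate 2 a) ^+ 3 - 3%:R * (2%:R * dilate 2 a) * dilate 2 b ^+ 2).
  by ring.
rewrite -sE -pE; ring.
Qed.

Let x : series := twist theta ^+ 2.
Let y : series := theta ^+ 2.
(** The series [t] of the introduction, with [x] and [y] as its numerator and
    denominator. *)
Definition theta_ratio : series := twist theta ^+ 2 / theta ^+ 2.
Local Notation t := theta_ratio.

Let y_unit : y \is a GRing.unit. Proof. by rewrite unitrX // theta_unit. Qed.
Let yV : y^-1 * y = 1. Proof. exact: mulVr. Qed.
Let dyV n : dilate 2 y ^+ n * dilate 2 (y^-1 ^+ n) = 1.
Proof. by rewrite -(rmorphXn (@dilate int 2)) -rmorphM -exprMn mulrV // expr1n rmorph1. Qed.
Let xy : x * y = dilate 2 y ^+ 2.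
Proof. by rewrite -exprMn mulrC theta_twist -rmorphXn. Qed.
Let tw_x : twist x = y. Proof. by rewrite rmorphXn /= twistK. Qed.
Let xDy : x + y = 2%:R * dilate 2 x.
Proof. by rewrite -tw_x -dilate_evenpart evenpart_theta_sqr. Qed.

(** [1 / y = x / y(q^2)^2], and [evenpart] fixes [x]. *)
Lemma evenpart_theta_inv : evenpart (y^-1) = t / y.
Proof.
have yVE : y^-1 = x * dilate 2 (y^-1 ^+ 2).
  by apply: (mulrI y_unit); rewrite mulrV // mulrA [y * x]mulrC xy dyV.
rewrite {1}yVE evenpart_dilate2M evenpart_theta_sqr /theta_ratio -/x -/y.
by rewrite expr2 mulrA.
Qed.

(** Multiplying numerator and denominator by [x^2] makes the denominator
    [(x y)^2 = y(q^2)^4], which [evenpart] turns into [y^4]. *)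
Lemma evenpart_theta_ratio : evenpart (t / y) = (4%:R * t ^+ 3 - 3%:R * t) / y.
Proof.
have tyE : t / y = x ^+ 3 * dilate 2 (y^-1 ^+ 4).
  apply: (mulrI y_unit); apply: (mulrI y_unit); rewrite /theta_ratio -/x -/y.
  transitivity x.
    transitivity (x * (y^-1 * y) * (y^-1 * y)); first by ring.
    by rewrite yV !mulr1.
  transitivity (x * (x * y) ^+ 2 * dilate 2 (y^-1 ^+ 4)); last by ring.
  by rewrite xy -exprM -mulrA dyV mulr1.
rewrite {1}tyE evenpart_dilate2M (evenpart_cube tw_x xDy xy) /theta_ratio -/x -/y.
transitivity (4%:R * x ^+ 3 * y^-1 ^+ 4 - 3%:R * x * y^-1 ^+ 2 * (y^-1 * y) ^+ 2).
  by ring.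
by rewrite yV; ring.
Qed.

(** Since [theta] is congruent to [1] modulo [2], fourth powers of such series
    are congruent to [1] modulo [8], and [t] is [(theta(-q) / theta(q^2))^4]. *)
Lemma theta_ratio_mod8 : exists u, t = 1 + 8%:R * u.
Proof.
have [S SE] := theta_odd.
pose G (f : series) := f + 3%:R * f ^+ 2 + 4%:R * f ^+ 3 + 2%:R * f ^+ 4.
have GE f : (1 + 2%:R * f) ^+ 4 = 1 + 8%:R * G f by rewrite /G; ring.
have t4 : t * dilate 2 theta ^+ 4 = twist theta ^+ 4.
  rewrite (exprM _ 2 2) -theta_twist exprMn /theta_ratio mulrA.
  by rewrite divrK // -exprD.
have d_unit : dilate 2 theta ^+ 4 \is a GRing.unit.
  by rewrite unitrX // rmorph_unit // theta_unit.
exists ((G (twist S) - G (dilate 2 S)) / dilate 2 theta ^+ 4).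
apply: (mulIr d_unit); rewrite t4 mulrDl mulrA mulrVK //.
have -> : twist theta = 1 + 2%:R * twist S.
  by rewrite SE rmorphD rmorph1 rmorphM rmorph_nat.
have -> : dilate 2 theta = 1 + 2%:R * dilate 2 S.
  by rewrite SE rmorphD rmorph1 rmorphM rmorph_nat.
rewrite !GE; ring.
Qed.

(** Modulo [64] the cubic [4 t^3 - 3 t] is the affine [9 t - 8], as [t] is
    congruent to [1] modulo [8]. *)
Lemma iter_evenpart_theta_inv alpha : exists (a b : int) (h : series),
  iter alpha (@evenpart int) y^-1 =
  a%:~R * y^-1 + b%:~R * (t / y) + 64%:R * h.
Proof.
have [u tE] := theta_ratio_mod8.
pose k := y^-1 * (12%:R * u ^+ 2 + 32%:R * u ^+ 3).
have cheb : (4%:R * t ^+ 3 - 3%:R * t) / y =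
    9%:R * (t / y) - 8%:R * y^-1 + 64%:R * k.
  rewrite /k tE; ring.
have evenpartZ (c : int) f : evenpart (c%:~R * f) = c%:~R * evenpart f.
  by rewrite !mulrzl raddfMz.
have evenpart64 f : evenpart (64%:R * f) = 64%:R * evenpart f.
  by rewrite !mulr_natl raddfMn.
elim: alpha => [|alpha [a [b [h IHa]]]].
  by exists 1, 0, 0; rewrite mulr0 mul0r !addr0 mul1r.
exists (- 8 * b), (a + 9 * b), (b%:~R * k + evenpart h).
rewrite iterS IHa 2!(raddfD (@evenpart int)) /= !evenpartZ evenpart64.
rewrite evenpart_theta_inv evenpart_theta_ratio {}cheb.
move: (t / y) (y^-1) k => v w k'; ring.
Qed.

(** Logarithmic differentiation: [q t'] is [4 t (lambert - lambert(-q))], and the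
    difference doubles the odd part of [lambert]. One factor [t] may be replaced
    by [1] at the cost of a multiple of [64]. *)
Lemma coef_theta_ratio m : odd m ->
  exists v : int, m%:Z * (theta_ratio m) = 8%:Z * lambert m + 64%:Z * v.
Proof.
move=> m_odd; have [u tE] := theta_ratio_mod8.
pose Lo : series := Fps (fun n => (odd n)%:R * lambert n).
have LoE : lambert - twist lambert = 2%:R * Lo.
  apply: fpsP => n; rewrite fpsBE coef_natr twistE -signr_odd.
  have -> : Lo n = (odd n)%:R * lambert n by [].
  by case: (odd n); move: (lambert n) => l /=; ring.
have DE : qderiv t = 8%:R * t * Lo.
  have Dsqr (f : series) : qderiv (f ^+ 2) = 2%:R * f * qderiv f.
    by rewrite expr2 qderivM; ring.
  have Dy : qderiv y = - 4%:R * y * lambert.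
    by rewrite Dsqr qderiv_theta /y; ring.
  have Dx : qderiv x = - 4%:R * x * twist lambert.
    rewrite Dsqr qderiv_twist qderiv_theta.
    by rewrite !rmorphM rmorphN rmorph_nat /= /x; ring.
  have tyE : t * y = x by rewrite divrK.
  have := congr1 (@qderiv int) tyE; rewrite qderivM Dy Dx -tyE => E.
  apply: (mulIr y_unit); apply: (addIr (t * (- 4%:R * y * lambert))); rewrite {}E.
  transitivity (4%:R * (t * y) * (lambert - twist lambert - lambert)).
    by ring.
  rewrite LoE; ring.
exists ((u * Lo) m).
have -> : m%:Z * t m = qderiv t m by rewrite /= natz.
rewrite DE tE.
have -> : 8%:R * (1 + 8%:R * u) * Lo = 8%:R * Lo + 64%:R * (u * Lo) by ring.
have -> : lambert m = Lo m by rewrite /= m_odd mul1r.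
by rewrite fpsDE !coef_natr.
Qed.

End Recursion.

(** * Divisor sums *)

Definition sigma n := \sum_(d <- divisors n) d.

Lemma divisors_perm n : 0 < n ->
  perm_eq (divisors n) [seq d <- index_iota 1 n.+1 | d %| n].
Proof.
move=> n0; apply: uniq_perm; rewrite ?divisors_uniq ?filter_uniq ?iota_uniq //.
move=> d; rewrite mem_filter mem_index_iota -dvdn_divisors //.
case: (boolP (d %| n)) => //= dn; rewrite ltnS.
by rewrite (dvdn_gt0 n0 dn) dvdn_leq.
Qed.

Lemma lambert_odd m : odd m -> (lambert m = (sigma m)%:Z)%R.
Proof.
move=> m_odd; have m0 : 0 < m by case: m m_odd.
rewrite /sigma (perm_big _ (divisors_perm m0)) big_filter big_mkcond /=.
rewrite -natz GRing.natr_sum; apply: eq_bigr => d _.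
case: ifP => [/dvdnP[k mE]|_] /=; last by rewrite GRing.mulr0.
have d0 : 0 < d by move: m0; rewrite mE muln_gt0 => /andP[].
by move: m_odd; rewrite mE mulnK // oddM => /andP[-> _]; rewrite GRing.mulr1.
Qed.

(** By induction on [e]: the divisors of [p^(e+1) m] are those of [m], prime to
    [p], and [p] times those of [p^e m]. *)
Lemma sigma_primeX_mul p e m : prime p -> 0 < m -> ~~ (p %| m) ->
  sigma (p ^ e * m) = (\sum_(0 <= i < e.+1) p ^ i) * sigma m.
Proof.
move=> p_pr m0 pm; have p0 := prime_gt0 p_pr.
elim: e => [|e IHe]; first by rewrite big_nat1 !mul1n.
have -> : sigma (p ^ e.+1 * m) = sigma m + p * sigma (p ^ e * m).
  rewrite /sigma big_distrr /= -(big_map (muln p) xpredT id) -big_cat.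
  apply: perm_big; apply: uniq_perm; first exact: divisors_uniq.
    rewrite cat_uniq !divisors_uniq map_inj_uniq ?divisors_uniq ?andbT /=.
      apply/hasPn => _ /mapP[d _ ->]; rewrite /= -dvdn_divisors //.
      by apply: contraNN pm => /(dvdn_trans (dvdn_mulr _ (dvdnn p))).
    by move=> a b /eqP; rewrite eqn_pmul2l // => /eqP.
  move=> d; rewrite mem_cat -!dvdn_divisors ?muln_gt0 ?expn_gt0 ?p0 //.
  case: (boolP (p %| d)) => [/dvdnP[d' ->]|pd].
    have -> : (d' * p %| m) = false.
      by apply: contraNF pm => /(dvdn_trans (dvdn_mull _ (dvdnn p))).
    rewrite mulnC expnS -mulnA dvdn_pmul2l // mem_map; last first.
      by move=> a b /eqP; rewrite eqn_pmul2l // => /eqP.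
    by rewrite -dvdn_divisors // muln_gt0 expn_gt0 p0.
  rewrite Gauss_dvdr; last by rewrite coprime_sym coprimeXl // prime_coprime.
  rewrite -[LHS]orbF; congr (_ || _); apply/esym/negP => /mapP[d' _ dE].
  by rewrite dE dvdn_mulr in pd.
rewrite IHe [in RHS]big_nat_recl // expn0 mulnDl mul1n mulnA.
congr (_ + _ * _); rewrite big_distrr.
by apply: eq_bigr => i _; rewrite expnS.
Qed.

Lemma geometric_dvd p a k :
  \sum_(0 <= i < a) p ^ i %| \sum_(0 <= i < a * k) p ^ i.
Proof.
elim: k => [|k IHk]; first by rewrite muln0 [X in _ %| X]big_geq.
rewrite mulnS [X in _ %| X](@big_cat_nat _ _ _ a) ?leq_addr //=.
have -> : \sum_(a <= i < a + a * k) p ^ i = p ^ a * \sum_(0 <= i < a * k) p ^ i.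
  rewrite -{1}[a]add0n big_addn addKn big_distrr /=.
  by apply: eq_bigr => i _; rewrite expnD mulnC.
by rewrite dvdn_add // dvdn_mull.
Qed.

(** The sum is the product of the [1 + p^(2^i)] for [i < j]. *)
Lemma geometric_dvd8 j p : 1 <= j -> j < 4 -> 2 ^ (4 - j) %| p.+1 ->
  8 %| \sum_(0 <= i < 2 ^ j) p ^ i.
Proof.
case: j => [|[|[|[|]]]] // _ _ /dvdnP[c pE]; rewrite !big_nat_recr //= big_geq //.
- have {}pE : p.+1 = c * 8 := pE.
  by apply/dvdnP; exists c; rewrite expn1 -pE.
- have {}pE : p.+1 = c * 4 := pE.
  rewrite (_ : _ + _ = p.+1 * (p ^ 2).+1); last by rewrite expn1; lia.
  apply: (@dvdn_mul 4 2); first by rewrite pE dvdn_mull.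
  by rewrite dvdn2 /= oddX; lia.
- have {}pE : p.+1 = c * 2 := pE.
  rewrite (_ : _ + _ = p.+1 * (p ^ 2).+1 * (p ^ 4).+1); last by rewrite expn1; lia.
  have p_odd : odd p by lia.
  apply: (@dvdn_mul 4 2); first apply: (@dvdn_mul 2 2).
  all: by rewrite dvdn2 /= ?oddX p_odd.
Qed.

Lemma sigma_dvd8 j p k m : 1 <= j -> j < 4 -> 0 < k -> prime p ->
  2 ^ (4 - j) %| p.+1 -> 0 < m -> ~~ (p %| m) ->
  8 %| sigma (p ^ (2 ^ j * k - 1) * m).
Proof.
move=> j1 j4 k0 p_pr pj m0 pm; rewrite sigma_primeX_mul // dvdn_mulr //.
rewrite subn1 prednK ?muln_gt0 ?expn_gt0 //.
exact: dvdn_trans (geometric_dvd8 j1 j4 pj) (geometric_dvd _ _ _).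
Qed.

(** * Counting overpartitions *)

Lemma opart_geq_trans : transitive opart_geq.
Proof.
move=> [y b] [x a] [z c]; rewrite /opart_geq /=.
by case: a; case: b; rewrite ?andbF ?andbT ?orbF; lia.
Qed.

Lemma overpartition_cons x s :
  overpartition (x :: s) = [&& 0 < x.1, all (opart_geq x) s & overpartition s].
Proof.
rewrite /overpartition /= (path_sortedE opart_geq_trans).
by rewrite -!andbA; congr (_ && _); rewrite andbCA.
Qed.

Lemma weight_cons x s : weight (x :: s) = x.1 + weight s.
Proof. by rewrite /weight big_cons. Qed.

Definition restricted (Q : pred nat) i n (s : seq opart) :=
  [&& overpartition s, all (fun x => Q x.1 && (x.1 <= i)) s & weight s == n].

(** Removing the first part, if it has the maximal size allowed: an overlined
    part is the last one of its size. *)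
Lemma restrictedS (Q : pred nat) i n x s : Q i.+1 ->
  restricted Q i.+1 n (x :: s) =
  restricted Q i n (x :: s) ||
  (i.+1 <= n) && ((x == (i.+1, true)) && restricted Q i (n - i.+1) s ||
                  (x == (i.+1, false)) && restricted Q i.+1 (n - i.+1) s).
Proof.
move=> Qi; rewrite /restricted; case: x => a b.
have shape c : [&& overpartition ((a, b) :: s),
    all (fun x => Q x.1 && (x.1 <= c)) ((a, b) :: s) & weight ((a, b) :: s) == n] =
    [&& 0 < a, Q a, a <= c, overpartition s, a + weight s == n
      & all (fun y => opart_geq (a, b) y && (Q y.1 && (y.1 <= c))) s].
  rewrite overpartition_cons weight_cons.
  have -> : all (fun y => opart_geq (a, b) y && (Q y.1 && (y.1 <= c))) s =
      all (opart_geq (a, b)) s && all (fun y => Q y.1 && (y.1 <= c)) s.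
    by rewrite -all_predI.
  rewrite /=; move: (all _ s) (all _ s) (overpartition s) (a + weight s == n).
  by move: (0 < a) (Q a) (a <= c) => [] [] [] [] [] [] [].
rewrite !shape !xpair_eqE.
case: (ltngtP a i.+1) => [ai|ai|->]; rewrite ?andbF //=.
- have -> : (a <= i) = true by rewrite -ltnS.
  rewrite !orbF /=; congr [&& _, _, _, _ & _].
  apply: eq_all => -[y c] /=; rewrite /opart_geq /=; lia.
- have -> : (a <= i) = false by lia.
  by rewrite !andbF.
rewrite ltnn Qi !andbF /=.
have -> : (i.+1 + weight s == n) = (i.+1 <= n) && (weight s == n - i.+1) by lia.
have -> : all (fun y => [&& opart_geq (i.+1, b) y, Q y.1 & y.1 <= i.+1]) s =
    all (fun y => Q y.1 && (y.1 <= if b then i else i.+1)) s.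
  apply: eq_all => -[y c] /=; rewrite /opart_geq /=.
  by case: b {shape}; case: (Q y) => /=; lia.
case: b {shape} => /=; rewrite ?orbF.
all: by move: (all _ s) (overpartition s) (_ == _) (i < n) => [] [] [] [].
Qed.

Section Counting.
Local Open Scope ring_scope.
Import GRing.Theory Num.Theory.
Local Notation series := (fps int).
Local Notation q := (fpsX int).
Implicit Type Q : pred nat.

(** The reciprocal factors [(1 + q^r) / (1 - q^r)] generate the overpartitions
    with all parts of size [r]. *)
Definition parts_gf Q i : series := \prod_(1 <= r < i.+1 | Q r) (theta_factor r)^-1.

Lemma parts_gfS Q i :
  parts_gf Q i.+1 = parts_gf Q i * (if Q i.+1 then (theta_factor i.+1)^-1 else 1).
Proof.
by rewrite /parts_gf big_mkcond big_nat_recr //= -big_mkcond.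
Qed.

(** The coefficients of [(1 - q^r) G' = (1 + q^r) G] for [r = i + 1]. *)
Lemma parts_gfS_coef Q i n : Q i.+1 ->
  parts_gf Q i.+1 n = parts_gf Q i n +
  (if (i < n)%N then parts_gf Q i (n - i.+1)%N + parts_gf Q i.+1 (n - i.+1)%N
   else 0).
Proof.
move=> Qi.
have E : parts_gf Q i.+1 =
    parts_gf Q i + q ^+ i.+1 * (parts_gf Q i + parts_gf Q i.+1).
  have := parts_gfS Q i; rewrite Qi => GE.
  have GE' : parts_gf Q i = parts_gf Q i.+1 * theta_factor i.+1.
    by rewrite GE divrK // theta_factor_unit.
  transitivity (parts_gf Q i.+1 * ((1 - q ^+ i.+1) + q ^+ i.+1)); first by ring.
  rewrite -theta_factorE.
  transitivity ((1 + q ^+ i.+1) * (parts_gf Q i.+1 * theta_factor i.+1)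
    + q ^+ i.+1 * parts_gf Q i.+1); first by ring.
  rewrite -GE'; ring.
rewrite {1}E fpsDE coef_qXM ltnS leqNgt; congr (_ + _).
by case: ltnP.
Qed.

Lemma mem_map_cons (T : eqType) (x y : T) s (L : seq (seq T)) :
  (x :: s \in map (cons y) L) = (x == y) && (s \in L).
Proof.
apply/mapP/andP => [[s' s'L [-> ->]]|[/eqP -> sL]]; first by rewrite eqxx.
by exists s.
Qed.

Lemma nil_map_cons (T : eqType) (y : T) (L : seq (seq T)) :
  ([::] \in map (cons y) L) = false.
Proof. by apply/negP => /mapP[]. Qed.

(** Removing the first part gives for the enumerations the recursion of
    [parts_gfS_coef]. *)
Lemma restricted_enum Q i n : exists L : seq (seq opart),
  [/\ uniq L, forall s, (s \in L) = restricted Q i n s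
    & (size L)%:Z = parts_gf Q i n].
Proof.
elim: i n => [|i IHi] n.
  exists (if n == 0%N then [:: [::]] else [::]).
  split; first by case: eqP.
    case=> [|[a b] s].
      by rewrite /restricted /weight big_nil /= eq_sym; case: eqP.
    rewrite /restricted overpartition_cons /=.
    case: a => [|a]; first by case: eqP.
    by rewrite ltn0 !andbF; case: eqP.
  by rewrite /parts_gf big_geq // fps1E; case: eqP.
case Qi : (Q i.+1); last first.
  have [L [L_uniq LE L_size]] := IHi n; exists L; split=> // [s|].
    rewrite LE; congr [&& _, _ & _]; apply: eq_all => -[a b] /=.
    rewrite [in RHS]leq_eqVlt ltnS; case: eqP => //= ->.
    by rewrite Qi.
  by rewrite parts_gfS Qi mulr1.
elim/ltn_ind: n => n IHn.
have [L0 [L0_uniq L0E L0_size]] := IHi n.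
have restrict0 : restricted Q i.+1 n [::] = restricted Q i n [::] by [].
case: (ltnP i n) => i_n; last first.
  exists L0; split=> // [[|x s]|].
  - by rewrite L0E restrict0.
  - by rewrite restrictedS // [(i < n)%N]ltnNge i_n orbF.
  - by rewrite parts_gfS_coef // ltnNge i_n addr0.
have [L1 [L1_uniq L1E L1_size]] := IHi (n - i.+1)%N.
have [|L2 [L2_uniq L2E L2_size]] := IHn (n - i.+1)%N; first by lia.
exists (L0 ++ map (cons (i.+1, true)) L1 ++ map (cons (i.+1, false)) L2).
have cons_inj (y : opart) : injective (cons y) by move=> s1 s2 [].
split.
- rewrite !cat_uniq L0_uniq !map_inj_uniq // L1_uniq L2_uniq !andbT /=.
  apply/andP; split; apply/hasPn => -[|x s]; rewrite ?mem_cat ?nil_map_cons //.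
    rewrite !mem_map_cons => max_x; apply/negP.
    rewrite L0E /restricted /=; case: x max_x => a b.
    by case/orP=> /andP[/eqP[-> _] _]; rewrite ltnn !andbF.
  by rewrite !mem_map_cons => /andP[/eqP -> _]; rewrite xpair_eqE andbF.
- case=> [|x s]; rewrite !mem_cat ?nil_map_cons ?orbF ?mem_map_cons.
    by rewrite L0E restrict0.
  by rewrite restrictedS // i_n L0E L1E L2E.
- rewrite !size_cat !size_map !PoszD L0_size L1_size L2_size.
  by rewrite [RHS]parts_gfS_coef // i_n.
Qed.

Lemma restricted_bound Q i n s : (n <= i)%N ->
  restricted Q i n s = [&& overpartition s, all (fun x => Q x.1) s & weight s == n].
Proof.
move=> n_i; rewrite /restricted; case: (weight s =P n) => [sn|_]; last by rewrite !andbF.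
congr [&& _, _ & _]; apply: eq_in_all => x xs.
case: (Q _) => //=; apply: leq_trans n_i.
by rewrite -sn /weight (big_rem _ xs) /= leq_addr.
Qed.

Lemma Bbar_coef l n :
  (Bbar l n)%:Z = (parts_gf (fun r => ~~ (l %| r)%N) n ^+ 2) n.
Proof.
pose Q r := ~~ (l %| r)%N; rewrite -/Q.
have /choice[L LP] := restricted_enum Q n.
pose pairs := [seq st | a <- iota 0 n.+1,
  st <- [seq (s, t) | s <- L a, t <- L (n - a)%N]].
have mem_pairs st : (st \in pairs) = regular_overpartition_pair l n st.
  have memL a s : (a <= n)%N ->
      (s \in L a) = [&& overpartition s, regular l s & weight s == a].
    by move=> a_n; have [_ -> _] := LP a; rewrite restricted_bound.
  apply/allpairsPdep/idP => [[a [_ [a_n /allpairsP[[s t] /= [sL tL ->]] ->]]]|].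
    rewrite mem_iota ltnS /= in a_n; rewrite !memL ?leq_subr // in sL tL.
    have /and3P[s1 s2 /eqP s3] := sL; have /and3P[t1 t2 /eqP t3] := tL.
    by apply/and5P; split; rewrite //= s3 t3 subnKC.
  case: st => s t /and5P[/= s1 s2 t1 t2 /eqP st].
  have s_n : (weight s <= n)%N by rewrite -st leq_addr.
  have s_in : weight s \in iota 0 n.+1 by rewrite mem_iota ltnS.
  exists (weight s), (s, t); split=> //.
  apply/allpairsP; exists (s, t); split=> //=; rewrite memL ?leq_subr //.
    by rewrite s1 s2 eqxx.
  by rewrite t1 t2 -st addKn eqxx.
have pairs_uniq : uniq pairs.
  apply: allpairs_uniq_dep; first exact: iota_uniq.
    move=> a _; have [U _ _] := LP a; have [V _ _] := LP (n - a)%N.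
    by apply: allpairs_uniq => // -[s t] [s' t'] _ _.
  (* The index of the list a pair comes from is the weight of its first half. *)
  apply: (can_in_inj (g := fun st =>
    existT (fun=> (seq opart * seq opart)%type) (weight st.1) st)).
  move=> _ /allpairsPdep[a [_ [_ /allpairsP[[s t] /= [sL _ ->]] ->]]] /=.
  have [_ LE _] := LP a; move: sL; rewrite LE.
  by case/and3P=> _ _ /eqP ->.
have -> : Bbar l n = size pairs.
  rewrite /Bbar cardE -(size_map (@encode_pair n)); apply/perm_size/uniq_perm => //.
    by rewrite map_inj_uniq ?enum_uniq //; apply: encode_pair_inj.
  move=> st; rewrite mem_pairs; apply/mapP/idP => [[uv]|st_pair].
    by rewrite mem_enum inE => uv_pair ->.
  have [uv uvE] := encode_pairK st_pair; exists uv => //.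
  by rewrite mem_enum inE uvE.
rewrite size_allpairs_dep sumnE big_map expr2 fpsME -natz natr_sum.
rewrite -(big_mkord xpredT (fun a => parts_gf Q n a * parts_gf Q n (n - a)%N)).
rewrite /index_iota subn0; apply: eq_bigr => a _.
have [_ _ <-] := LP a; have [_ _ <-] := LP (n - a)%N.
by rewrite size_allpairs natrM !natz.
Qed.


(** The factors whose index is a multiple of [l] are those of [theta(q^l)], and
    the other ones are inverted by [parts_gf]. *)
Lemma parts_gf_theta l n : (0 < l)%N ->
  eqq n.+1 (parts_gf (fun r => ~~ (l %| r)%N) n) (dilate l theta / theta).
Proof.
move=> l0.
have partial_l : \prod_(1 <= r < n.+1 | (l %| r)%N) theta_factor r =
    dilate l (theta_partial (n %/ l)).
  elim: n => [|n IHn].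
    by rewrite div0n /theta_partial !big_geq // rmorph1.
  rewrite big_mkcond big_nat_recr //= -big_mkcond IHn divnS //.
  case: (boolP (l %| n.+1)%N) => [ln|_]; last by rewrite mulr1 add0n.
  have nE : n.+1 = (l * (n %/ l).+1)%N by rewrite mulnC -(divnK ln) divnS // ln.
  by rewrite add1n theta_partialS rmorphM /= dilate_theta_factor // -nE.
have partsE : parts_gf (fun r => ~~ (l %| r)%N) n * theta_partial n =
    dilate l (theta_partial (n %/ l)).
  rewrite -partial_l /theta_partial [in LHS](bigID (fun r => (l %| r)%N)) /= mulrCA.
  rewrite /parts_gf -big_split [X in _ * X]big1_seq ?mulr1 // => r.
  by rewrite mem_index_iota => /and3P[_ r0 _]; apply/mulVr/theta_factor_unit.
have E : eqq n.+1 (parts_gf (fun r => ~~ (l %| r)%N) n * theta) (dilate l theta).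
  apply: (@eqq_trans _ _ _ (parts_gf (fun r => ~~ (l %| r)%N) n * theta_partial n)).
    by apply: eqqM => //; apply: eqq_theta.
  rewrite partsE; apply: eqq_sym; apply: (@eqq_leq _ _ (l * (n %/ l).+1)).
    by rewrite mulnC -ltn_divLR.
  by apply: eqq_dilate => //; apply: eqq_theta.
rewrite -[parts_gf _ _](mulrK theta_unit).
exact: eqqM.
Qed.

Lemma Bbar_theta l n : (0 < l)%N ->
  (Bbar l n)%:Z = (dilate l (theta ^+ 2) / theta ^+ 2) n.
Proof.
move=> l0; rewrite Bbar_coef (eqqX 2 (parts_gf_theta (n := n) l0)) //.
by rewrite exprMn exprVn rmorphXn.
Qed.

End Counting.

(** * The congruence *)

Section Congruence.
Local Open Scope ring_scope.
Import GRing.Theory Num.Theory.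

Lemma iter_evenpart_dilate alpha (f g : fps int) :
  iter alpha (@evenpart int) (f * dilate (2 ^ alpha) g) =
  iter alpha (@evenpart int) f * g.
Proof.
elim: alpha f g => [|alpha IHalpha] f g; first by rewrite dilate1.
by rewrite !iterSr expnS -dilate_comp ?expn_gt0 // evenpart_dilate2M.
Qed.

Lemma iter_evenpartE alpha (f : fps int) n :
  iter alpha (@evenpart int) f n = f (2 ^ alpha * n)%N.
Proof.
elim: alpha n => [|alpha IHalpha] n; first by rewrite mul1n.
by rewrite iterS /= IHalpha expnS mulnCA mulnA.
Qed.

Lemma fps_intM (c : int) (f : fps int) n : (c%:~R * f) n = c * f n.
Proof.
case: c => c; first by rewrite -pmulrn coef_natr natz.
by rewrite NegzE mulrNz mulNr fpsNE -pmulrn coef_natr natz mulNr.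
Qed.

(** The constant [a] contributes only to the coefficient of [q^0], and the odd
    factor [m] of [m t_m] can be cancelled modulo [64]. *)
Lemma Bbar_sigma alpha m : odd m -> (8 %| sigma m)%N ->
  (2 ^ 6 %| Bbar (2 ^ alpha) (2 ^ alpha * m))%N.
Proof.
move=> m_odd sigma8.
have [a [b [h E]]] := iter_evenpart_theta_inv alpha.
have BE : (Bbar (2 ^ alpha) (2 ^ alpha * m))%:Z =
    b * theta_ratio m + 64%:Z * (h * theta ^+ 2) m.
  rewrite Bbar_theta ?expn_gt0 // -iter_evenpartE mulrC iter_evenpart_dilate E.
  have -> : (a%:~R / theta ^+ 2 + b%:~R * (theta_ratio / theta ^+ 2) + 64%:R * h)
      * theta ^+ 2 = a%:~R + b%:~R * theta_ratio + 64%:R * (h * theta ^+ 2).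
    transitivity ((a%:~R + b%:~R * theta_ratio) * ((theta ^+ 2)^-1 * theta ^+ 2)
      + 64%:R * (h * theta ^+ 2)); first by ring.
    by rewrite mulVr ?mulr1 // unitrX // theta_unit.
  rewrite 2!fpsDE coef_natr fps_intM -[a%:~R]mulr1 fps_intM fps1E.
  by case: m m_odd {sigma8} => // m _; rewrite mulr0 add0r.
have [v vE] := coef_theta_ratio m_odd.
rewrite lambert_odd // in vE.
have [s sE] : exists s, sigma m = (s * 8)%N by apply/dvdnP.
have : (64 %| m%:Z * (Bbar (2 ^ alpha) (2 ^ alpha * m))%:Z)%Z.
  apply/dvdzP; exists (b * (s%:Z + v) + m%:Z * (h * theta ^+ 2) m).
  rewrite BE mulrDr mulrCA vE sE PoszM; ring.
rewrite -PoszM dvdzE /= Gauss_dvdr //.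
by rewrite (@coprimeXl 6 2) // coprime2n.
Qed.

End Congruence.

Theorem corollary1p3 (n j p : nat) (hj1 : 1 <= j) (hj4 : j < 4)
    (hp : prime p) (hpn : ~~ (p %| 2 * n + 1))
    (hpj : (p%:Z = -1 %[mod (2 ^ (4 - j))%N])%Z)
    (alpha k : nat) (halpha : 1 <= alpha) (hk : 1 <= k) :
  Bbar (2 ^ alpha) (2 ^ alpha * p ^ (2 ^ j * k - 1) * (2 * n + 1))
    = 0 %[mod 2 ^ 6].
Proof.
have p_dvd : 2 ^ (4 - j) %| p.+1.
  by move/eqP: hpj; rewrite eqz_mod_dvd dvdzE GRing.opprK -PoszD addn1.
have p_odd : odd p.
  have : 2 %| p.+1.
    by apply: dvdn_trans p_dvd; rewrite -[X in X %| _]expn1 dvdn_exp2l // subn_gt0.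
  by rewrite dvdn2 /= negbK.
rewrite -mulnA mod0n; apply/eqP/Bbar_sigma.
  by rewrite oddM oddX p_odd orbT addn1 /= oddM.
by rewrite sigma_dvd8 // addn1.
Qed.
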